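(* Let $\Xi_{\mathrm{rob}}$ be constructed using Algorithm A (described in the context), and let $x^*$ be an optimal solution of the robust problem $$\min_{x\in\mathbb{R}^{n_x}}\ c^\top x\quad\text{s.t.}\quad \Lambda x\le\beta,\qquad e_k^\top x+f_k^\top\xi+x^\top F_k\xi\le h_k\quad\forall\,\xi\in\Xi_{\mathrm{rob}},\ \forall k\in[K].$$ Then $x^*$ is a feasible solution of the distributionally robust chance-constrained problem $$\min_{x\in\mathbb{R}^{n_x}}\ c^\top x\quad\text{s.t.}\quad \Lambda x\le\beta,\qquad \inf_{\mathbb{Q}\in\mathcal{M}_N^\theta}\mathbb{Q}\bigl(e_k^\top x+f_k^\top\xi+x^\top F_k\xi\le h_k,\ \forall k\in[K]\bigr)\ge 1-\epsilon .$$
   Context: Problem data. $c\in\mathbb{R}^{n_x}$, a real matrix $\Lambda$ with $n_x$ columns and a vector $\beta$ of matching dimension, and, for $k\in[K]=\{1,\dots,K\}$, $e_k\in\mathbb{R}^{n_x}$, $f_k\in\mathbb{R}^{n_\xi}$, $F_k\in\mathbb{R}^{n_x\times n_\xi}$, $h_k\in\mathbb{R}$ are given. Vector inequalities are componentwise. Uncertainty and partition. The uncertainty is a vector $\xi\in\mathbb{R}^{n_\xi}$ whose components are indexed by a finite set $\mathcal{W}=\{w_1,\dots,w_{n_\xi}\}$. The set $\mathcal{W}$ is partitioned into pairwise disjoint nonempty subsets $\mathcal{W}_1,\dots,\mathcal{W}_{n_W}$ with union $\mathcal{W}$. For $\xi\in\mathbb{R}^{n_\xi}$, $\xi^i\in\mathbb{R}^{|\mathcal{W}_i|}$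 denotes the subvector of components indexed by $\mathcal{W}_i$; we identify $\xi$ with $(\xi^1,\dots,\xi^{n_W})$. Support. The support set is compact, $\Xi\subset\mathbb{R}_{\ge 0}^{n_\xi}$, and has the form $\Xi=\prod_{i\in[n_W]}\Xi^i$ with $\Xi^i=\{\xi^i\in\mathbb{R}^{|\mathcal{W}_i|} \mid \Gamma^i\xi^i\le\rho^i\}$ for given $\Gamma^i\in\mathbb{R}^{u_i\times|\mathcal{W}_i|}$, $\rho^i\in\mathbb{R}^{u_i}$. Ambiguity set. Given samples $\hat\xi_1,\dots,\hat\xi_N\in\Xi$, let $\hat{\mathbb{Q}}_N=\frac1N\sum_{m=1}^N\delta_{\hat\xi_m}$ be the empirical distribution. Given $\theta\ge 0$, let $\mathcal{M}_N^\theta=\{\mathbb{Q}\in\mathcal{P}(\Xi) \mid d_w(\mathbb{Q},\hat{\mathbb{Q}}_N)\le\theta\}$, where $\mathcal{P}(\Xi)$ is the set of probability distributions supported on $\Xi$ and $d_w(\mathbb{Q},\hat{\mathbb{Q}}_N)=\min_{\gamma}\int_{\Xi\times\Xi}\|\xi-\hat\xi\|\,\gamma(d\xi,d\hat\xi)$, the minimum being over distributions $\gamma$ on $\Xi\times\Xi$ with marginals $\mathbb{Q}$ and $\hat{\mathbb{Q}}_N$; $\|\cdot\|$ is a fixed norm on Euclidean space. The tolerance is $\epsilon\in(0,1)$. Algorithm A (construction of $\Xi_{\mathrm{rob}}$). (1) For each $i\in[n_W]$: compute the empirical covariance matrix $\widehat{\mathrm{Cov}}^i\in\mathbb{R}^{|\mathcal{W}_i|\times|\mathcal{W}_i|}$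 of the subvectors $(\hat\xi_1)^i,\dots,(\hat\xi_N)^i$, and its eigenvalues $\lambda_{(i,1)}\le\dots\le\lambda_{(i,|\mathcal{W}_i|)}$ with corresponding eigenvectors $v_{(i,1)},\dots,v_{(i,|\mathcal{W}_i|)}$; select an integer $\kappa_i\in\{0,\dots,|\mathcal{W}_i|-1\}$; set $n^{\mathrm{DR}}_i=\kappa_i+|\mathcal{W}_i|$. Let $n^{\mathrm{DR}}=\sum_{i=1}^{n_W}n_i^{\mathrm{DR}}$. (2) For $i\in[n_W]$ and $j\in[n_i^{\mathrm{DR}}]$ let $\zeta_{i,j}\in\mathbb{R}^{|\mathcal{W}_i|}$ be the $j$-th standard unit vector if $j\le|\mathcal{W}_i|$, and $\zeta_{i,j}=v_{(i,j-|\mathcal{W}_i|)}$ otherwise. Let $(\underline b_{i,j},\overline b_{i,j})$ be an optimal solution of $$\min_{(\underline b,\overline b)}\ \overline b-\underline b\quad\text{s.t.}\quad \underline b\le\overline b,\quad \inf_{\mathbb{Q}\in\mathcal{M}_N^\theta}\mathbb{Q}\bigl(\max\{\zeta_{i,j}^\top\xi^i-\overline b,\ \underline b-\zeta_{i,j}^\top\xi^i\}\le 0\bigr)\ge 1-\frac{\epsilon}{n^{\mathrm{DR}}}.$$ (3) Set $\Xi_{\mathrm{rob}}^{i,j}=\{\xi^i\in\mathbb{R}^{|\mathcal{W}_i|} \mid \underline b_{i,j}\le\zeta_{i,j}^\top\xi^i\le\overline b_{i,j}\}$, $\Xi_{\mathrm{rob}}^i=\bigcap_{j=1}^{n_i^{\mathrm{DR}}}\Xi_{\mathrm{rob}}^{i,j}$,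 and output $\Xi_{\mathrm{rob}}=\prod_{i=1}^{n_W}\Xi_{\mathrm{rob}}^i$. *)

(* Defs.v *)
From HB Require Import structures.
From mathcomp Require Import all_boot all_order all_algebra.
From mathcomp Require Import all_classical all_reals all_analysis.

Set Implicit Arguments.
Unset Strict Implicit.
Unset Printing Implicit Defensive.

Import Order.TTheory GRing.Theory Num.Theory.
Import numFieldNormedType.Exports.

Local Open Scope classical_set_scope.
Local Open Scope ring_scope.

Definition dot (R : realType) (n : nat) (u v : 'cV[R]_n) : R :=
  (u^T *m v) 0 0.

Definition lecv (R : realType) (m : nat) (u v : 'cV[R]_m) : Prop :=
  forall i, u i 0 <= v i 0.

Definition is_norm (R : realType) (n : nat) (nrm : 'cV[R]_n -> R) : Prop :=
  [/\ forall u, 0 <= nrm u,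
      forall u, nrm u = 0 -> u = 0,
      forall (a : R) u, nrm (a *: u) = `|a| * nrm u
    & forall u v, nrm (u + v) <= nrm u + nrm v].

Definition is_optimal (R : realType) (T : Type) (obj : T -> R) (feas : set T)
    (x : T) : Prop :=
  feas x /\ forall y, feas y -> obj x <= obj y.

Section UncertaintySpace.
Context (R : realType) (n nW : nat).
Implicit Type W : 'I_nW -> {set 'I_n}.

Definition is_indexed_partition W : Prop :=
  [/\ forall i, W i != finset.set0,
      forall i j, i != j -> W i :&: W j = finset.set0
    & forall a, exists i, a \in W i].

(* The coordinates of xi^i are those of xi with index in W_i, taken in
   increasing order. *)
Definition subvec W (i : 'I_nW) (xi : 'cV[R]_n) : 'cV[R]_#|W i| :=
  \col_(j < #|W i|) xi (enum_val j) 0.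

Definition polyhedron (m u : nat) (Gamma : 'M[R]_(u, m)) (rho : 'cV[R]_u) :
    set 'cV[R]_m :=
  [set z | lecv (Gamma *m z) rho].

Definition block_prod W (S : forall i, set 'cV[R]_#|W i|) : set 'cV[R]_n :=
  [set xi | forall i, S i (subvec W i xi)].

End UncertaintySpace.

(* R^n with its Borel sigma-algebra. *)
Definition borel_cV (R : realType) (n : nat) :=
  g_sigma_algebraType (@open 'cV[R]_n).

Section Ambiguity.
Context (R : realType) (n : nat).
Local Notation T := (borel_cV R n).

(* A distribution on Xi is a Borel probability measure on R^n giving mass 1
   to Xi. *)
Definition supported_on (Xi : set 'cV[R]_n) : set (probability T R) :=
  [set Q | Q Xi = 1%E].

Definition empirical (N : nat) (xihat : 'I_N -> 'cV[R]_n) (A : set T) :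
    \bar R :=
  ((N%:R^-1)%:E * \sum_(m < N) dirac (xihat m : T) A)%E.

Definition couplings (Xi : set 'cV[R]_n) (mu nu : set T -> \bar R) :
    set (probability (T * T)%type R) :=
  [set gamma : probability (T * T)%type R | [/\ gamma (Xi `*` Xi) = 1%E,
     forall A : set T, measurable A -> pushforward gamma (@fst T T) A = mu A
   & forall A : set T, measurable A -> pushforward gamma (@snd T T) A = nu A]].

(* The minimum over the couplings is written as the infimum in \bar R. *)
Definition wasserstein (nrm : 'cV[R]_n -> R) (Xi : set 'cV[R]_n)
    (mu nu : set T -> \bar R) : \bar R :=
  ereal_inf [set (\int[gamma]_(z in Xi `*` Xi)
                    (nrm ((z.1 : 'cV[R]_n) - (z.2 : 'cV[R]_n)))%:E)%E
            | gamma in couplings Xi mu nu].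

Definition ambiguity_set (nrm : 'cV[R]_n -> R) (Xi : set 'cV[R]_n)
    (N : nat) (xihat : 'I_N -> 'cV[R]_n) (theta : R) :
    set (probability T R) :=
  [set Q | supported_on Xi Q /\
           (wasserstein nrm Xi Q (empirical xihat) <= theta%:E)%E].

Definition worst_case_prob (M : set (probability T R)) (E : set 'cV[R]_n) :
    \bar R :=
  ereal_inf [set Q E | Q in M].

End Ambiguity.

Section RobustSet.
Context (R : realType).

Definition emp_mean (m N : nat) (z : 'I_N -> 'cV[R]_m) : 'cV[R]_m :=
  N%:R^-1 *: \sum_(s < N) z s.

Definition emp_cov (m N : nat) (z : 'I_N -> 'cV[R]_m) : 'M[R]_m :=
  N%:R^-1 *: \sum_(s < N) ((z s - emp_mean z) *m (z s - emp_mean z)^T).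

(* lambda lists the eigenvalues of A with multiplicity, in nondecreasing order,
   and v j is an eigenvector (a column) for lambda j. *)
Definition is_eigen_system (m : nat) (A : 'M[R]_m) (lambda : 'I_m -> R)
    (v : 'I_m -> 'cV[R]_m) : Prop :=
  [/\ char_poly A = \prod_(j < m) ('X - (lambda j)%:P),
      forall j k : 'I_m, (j <= k)%N -> lambda j <= lambda k
    & forall j, v j != 0 /\ A *m v j = lambda j *: v j].

(* The first m directions are the unit vectors, the next kappa ones are
   v 0, .., v (kappa - 1). *)
Definition direction (m : nat) (kappa : 'I_m) (v : 'I_m -> 'cV[R]_m)
    (j : 'I_(m + kappa)) : 'cV[R]_m :=
  match fintype.split j with
  | inl a => delta_mx a 0
  | inr b => v (widen_ord (ltnW (ltn_ord kappa)) b)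
  end.

Definition nDR (n nW : nat) (W : 'I_nW -> {set 'I_n})
    (kappa : forall i, 'I_#|W i|) : nat :=
  (\sum_(i < nW) (#|W i| + kappa i))%N.

(* Feasible pairs (blow, bup) of the interval problem for direction zeta in
   block i, at probability level p. *)
Definition interval_feasible (n nW : nat) (W : 'I_nW -> {set 'I_n})
    (M : set (probability (borel_cV R n) R)) (p : R) (i : 'I_nW)
    (zeta : 'cV[R]_#|W i|) : set (R * R) :=
  [set b | b.1 <= b.2 /\
    (p%:E <= worst_case_prob M
       [set xi | Num.max (dot zeta (subvec W i xi) - b.2)
                         (b.1 - dot zeta (subvec W i xi)) <= 0]%R)%E].

Definition interval_optimal (n nW : nat) (W : 'I_nW -> {set 'I_n})
    (M : set (probability (borel_cV R n) R)) (p : R) (i : 'I_nW)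
    (zeta : 'cV[R]_#|W i|) (b : R * R) : Prop :=
  is_optimal (fun b' => b'.2 - b'.1) (interval_feasible M p zeta) b.

Definition slab (m : nat) (zeta : 'cV[R]_m) (b : R * R) : set 'cV[R]_m :=
  [set z | b.1 <= dot zeta z <= b.2].

Definition Xi_rob (n nW : nat) (W : 'I_nW -> {set 'I_n})
    (kappa : forall i, 'I_#|W i|)
    (v : forall i, 'I_#|W i| -> 'cV[R]_#|W i|)
    (b : forall i, 'I_(#|W i| + kappa i) -> R * R) : set 'cV[R]_n :=
  block_prod (fun i => \bigcap_(j in [set: 'I_(#|W i| + kappa i)])
                         slab (direction (v i) j) (b i j)).

End RobustSet.

Section Problems.
Context (R : realType) (nx n K l : nat).
Variables (Lambda : 'M[R]_(l, nx)) (beta : 'cV[R]_l).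
Variables (e : 'I_K -> 'cV[R]_nx) (f : 'I_K -> 'cV[R]_n).
Variables (F : 'I_K -> 'M[R]_(nx, n)) (h : 'I_K -> R).

Definition safe (k : 'I_K) (x : 'cV[R]_nx) (xi : 'cV[R]_n) : Prop :=
  dot (e k) x + dot (f k) xi + (x^T *m F k *m xi) 0 0 <= h k.

Definition robust_feasible (U : set 'cV[R]_n) : set 'cV[R]_nx :=
  [set x | lecv (Lambda *m x) beta /\
           forall xi, U xi -> forall k, safe k x xi].

Definition drcc_feasible (M : set (probability (borel_cV R n) R)) (eps : R) :
    set 'cV[R]_nx :=
  [set x | lecv (Lambda *m x) beta /\
           ((1 - eps)%:E <=
              worst_case_prob M [set xi | forall k, safe k x xi])%E].

End Problems.

(* Main.v *)
Require Import Defs.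
From HB Require Import structures.
From mathcomp Require Import all_boot all_order all_algebra.
From mathcomp Require Import all_classical all_reals all_analysis.
From mathcomp Require Import lra.
Import Order.TTheory GRing.Theory Num.Theory.
Import numFieldNormedType.Exports.
Local Open Scope classical_set_scope.
Local Open Scope ring_scope.

(** The set Xi_rob is the intersection of the n^DR slabs
    b.1 <= <zeta, xi^i> <= b.2 cut out by the directions of the algorithm.
    Under every distribution Q of the ambiguity set, each slab is missed with
    probability at most eps / n^DR, because its bounds are feasible for the
    interval problem.  The union bound (probability_bigcap_ge) then says that
    Xi_rob is missed with probability at most eps (Xi_rob_probability_ge).  A
    robust feasible x is safe at every point of Xi_rob, so by monotonicity of Q
    the safety event has probability at least 1 - eps, and this passes to the
    infimum over Q.

    The union bound and monotonicity need the events to be Borel: all of them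
    are finite intersections of half-spaces, which are closed since linear
    forms are continuous (measurable_halfspace). *)

(** The union bound, in terms of complements: each A i fails with probability
    at most p i. *)
Lemma probability_bigcap_ge d (T : measurableType d) (R : realType)
    (P : probability T R) (I : finType) (A : I -> set T) (p : I -> R) :
    (forall i, measurable (A i)) ->
    (forall i, ((1 - p i)%:E <= P (A i))%E) ->
  ((1 - \sum_i p i)%:E <= P (\bigcap_i A i))%E.
Proof.
move=> mA pA.
have eqA : \bigcap_i A i = \big[setI/setT]_(i : I) A i.
  rewrite -bigcap_seq; apply: eq_bigcapl.
  by split=> i //= _; rewrite mem_index_enum.
rewrite {}eqA.
(* Measurability is carried along because the binary step complements the
   partial intersections. *)
suff [] : measurable (\big[setI/setT]_(i : I) A i) /\
    ((1 - \sum_i p i)%:E <= P (\big[setI/setT]_(i : I) A i))%E by [].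
elim/big_ind2: _ => [|p1 B p2 C [mB pB] [mC pC]|i _]; last by split.
- by split => //; rewrite subr0 probability_setT.
- have mBC : measurable (B `&` C) by exact: measurableI.
  split=> //.
  have : (P (~` (B `&` C)) <= P (~` B) + P (~` C))%E.
    by rewrite setCI; apply: measureU2; exact: measurableC.
  rewrite !probability_setC//.
  move: pB pC.
  rewrite -(fineK (fin_num_measure P _ mB)) -(fineK (fin_num_measure P _ mC)).
  rewrite -(fineK (fin_num_measure P _ mBC)) -!EFinB -EFinD !lee_fin.
  by move=> *; lra.
Qed.

Lemma continuous_coord_comb (R : realType) (n m : nat) (a : 'I_m -> R)
    (s : 'I_m -> 'I_n) :
  continuous (fun xi : 'cV[R]_n => \sum_j a j * xi (s j) 0 : R).
Proof.
apply: continuous_big => [|j _ xi]; first exact: add_continuous.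
exact: (cvgMl_tmp (a := a j) (@coord_continuous R n 1 (s j) 0 xi)).
Qed.

(** Reading the coordinates through an index map s covers both forms in use:
    on the whole vector (s the identity) and on a block xi^i (s the increasing
    enumeration of W_i). *)
Lemma measurable_halfspace (R : realType) (n m : nat) (a : 'I_m -> R)
    (s : 'I_m -> 'I_n) (r : R) :
  measurable ([set xi | \sum_j a j * xi (s j) 0 <= r] : set (borel_cV R n)).
Proof.
set A := (X in measurable X).
rewrite -(setCK A); apply: measurableC; apply: sub_sigma_algebra.
have : closed (A : set 'cV[R]_n).
  apply: (preimage_closed (D := [set y : R | y <= r])); last exact: closed_le.
  by move=> xi _; exact: continuous_coord_comb.
by rewrite -openC.
Qed.

Lemma dot_subvecE (R : realType) (n nW : nat) (W : 'I_nW -> {set 'I_n})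
    (i : 'I_nW) (zeta : 'cV[R]_#|W i|) (xi : 'cV[R]_n) :
  dot zeta (subvec W i xi) = \sum_j zeta j 0 * xi (enum_val j) 0.
Proof. by rewrite /dot mxE; apply: eq_bigr => j _; rewrite !mxE. Qed.

Lemma measurable_slab (R : realType) (n nW : nat) (W : 'I_nW -> {set 'I_n})
    (i : 'I_nW) (zeta : 'cV[R]_#|W i|) (b : R * R) :
  measurable ([set xi | slab zeta b (subvec W i xi)] : set (borel_cV R n)).
Proof.
set A := (X in measurable X).
have -> : A =
    [set xi | \sum_j zeta j 0 * xi (@enum_val _ (W i) j) 0 <= b.2] `&`
    [set xi | \sum_j - zeta j 0 * xi (@enum_val _ (W i) j) 0 <= - b.1].
  apply/seteqP; split=> xi; rewrite /A /slab /= dot_subvecE;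
    under [X in _ /\ X <= _]eq_bigr do rewrite mulNr;
    rewrite sumrN lerN2.
  - by case/andP.
  - by case=> -> ->.
by apply: measurableI; exact: measurable_halfspace.
Qed.

Lemma interval_eventE (R : realType) (n nW : nat) (W : 'I_nW -> {set 'I_n})
    (i : 'I_nW) (zeta : 'cV[R]_#|W i|) (b : R * R) :
  [set xi | Num.max (dot zeta (subvec W i xi) - b.2)
                    (b.1 - dot zeta (subvec W i xi)) <= 0] =
  [set xi | slab zeta b (subvec W i xi)].
Proof.
by apply/funext => xi /=; rewrite ge_max !subr_le0 andbC.
Qed.

(** For fixed x each constraint is affine in xi, with linear part
    f_k^T + x^T F_k, so the safety event is a finite intersection of
    half-spaces. *)
Lemma measurable_safe (R : realType) (nx n K : nat) (e : 'I_K -> 'cV[R]_nx)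
    (f : 'I_K -> 'cV[R]_n) (F : 'I_K -> 'M[R]_(nx, n)) (h : 'I_K -> R)
    (x : 'cV[R]_nx) :
  measurable ([set xi | forall k, safe e f F h k x xi] : set (borel_cV R n)).
Proof.
have -> : [set xi | forall k, safe e f F h k x xi] =
    \bigcap_k [set xi | \sum_j ((f k)^T + x^T *m F k) 0 j * xi j 0
                        <= h k - dot (e k) x].
  have safeE k xi : safe e f F h k x xi =
      (\sum_j ((f k)^T + x^T *m F k) 0 j * xi j 0 <= h k - dot (e k) x).
    rewrite /safe -addrA -lerBrDl /dot.
    have -> : \sum_j ((f k)^T + x^T *m F k) 0 j * xi j 0 =
        (((f k)^T + x^T *m F k) *m xi) 0 0 by rewrite [RHS]mxE.
    by rewrite mulmxDl [in RHS]mxE.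
  by apply/seteqP; split=> xi /= H k; [move=> _|]; have := H k;
    rewrite safeE //; apply.
by apply: fin_bigcap_measurable => // k _; exact: measurable_halfspace.
Qed.

Lemma Xi_rob_bigcap (R : realType) (n nW : nat) (W : 'I_nW -> {set 'I_n})
    (kappa : forall i, 'I_#|W i|)
    (v : forall i, 'I_#|W i| -> 'cV[R]_#|W i|)
    (b : forall i, 'I_(#|W i| + kappa i) -> R * R) :
  Xi_rob v b = \bigcap_i \bigcap_j
    [set xi | slab (direction (v i) j) (b i j) (subvec W i xi)].
Proof.
by apply/seteqP; split=> xi /= H i; [move=> _ j _|move=> j _]; exact: H.
Qed.

Lemma measurable_Xi_rob (R : realType) (n nW : nat) (W : 'I_nW -> {set 'I_n})
    (kappa : forall i, 'I_#|W i|)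
    (v : forall i, 'I_#|W i| -> 'cV[R]_#|W i|)
    (b : forall i, 'I_(#|W i| + kappa i) -> R * R) :
  measurable (Xi_rob v b : set (borel_cV R n)).
Proof.
rewrite Xi_rob_bigcap; apply: fin_bigcap_measurable => // i _.
by apply: fin_bigcap_measurable => // j _; exact: measurable_slab.
Qed.

(** The union bound is applied inside each block, then across the blocks; the
    losses eps / n^DR add up to at most eps. *)
Lemma Xi_rob_probability_ge (R : realType) (n nW : nat)
    (W : 'I_nW -> {set 'I_n}) (kappa : forall i, 'I_#|W i|)
    (v : forall i, 'I_#|W i| -> 'cV[R]_#|W i|)
    (b : forall i, 'I_(#|W i| + kappa i) -> R * R)
    (Q : probability (borel_cV R n) R) (eps : R) (eps_ge0 : 0 <= eps) :
    (forall i j, ((1 - eps / (nDR kappa)%:R)%:E <=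
       Q [set xi | slab (direction (v i) j) (b i j) (subvec W i xi)])%E) ->
  ((1 - eps)%:E <= Q (Xi_rob v b))%E.
Proof.
move=> Qslab; set d := eps / (nDR kappa)%:R in Qslab.
have : ((1 - \sum_(i < nW) \sum_(j < #|W i| + kappa i) d)%:E <=
    Q (Xi_rob v b))%E.
  rewrite Xi_rob_bigcap; apply: probability_bigcap_ge => i.
    by apply: fin_bigcap_measurable => // j _; exact: measurable_slab.
  by apply: probability_bigcap_ge => j; [exact: measurable_slab|exact: Qslab].
apply: le_trans; rewrite lee_fin lerD2l lerN2.
under eq_bigr do rewrite sumr_const card_ord.
rewrite sumrMnr -/(nDR kappa) /d.
(* With no direction at all the division is by zero, and the sum is 0. *)
have [->|nz] := eqVneq (nDR kappa) 0%N; first by rewrite mulr0n.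
by rewrite -(mulr_natr (eps / _)) divfK// pnatr_eq0.
Qed.

Theorem mainTheorem3 (R : realType) (nx n nW K l N : nat)
  (* problem data *)
  (c : 'cV[R]_nx) (Lambda : 'M[R]_(l, nx)) (beta : 'cV[R]_l)
  (e : 'I_K -> 'cV[R]_nx) (f : 'I_K -> 'cV[R]_n)
  (F : 'I_K -> 'M[R]_(nx, n)) (h : 'I_K -> R)
  (* partition of the uncertainty *)
  (W : 'I_nW -> {set 'I_n}) (hW : is_indexed_partition W)
  (* support *)
  (u : 'I_nW -> nat)
  (Gamma : forall i, 'M[R]_(u i, #|W i|)) (rho : forall i, 'cV[R]_(u i))
  (Xi : set 'cV[R]_n)
  (hXi : Xi = block_prod (fun i => polyhedron (Gamma i) (rho i)))
  (hXi_compact : compact Xi)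
  (hXi_ge0 : forall xi, Xi xi -> lecv 0 xi)
  (* ambiguity set *)
  (nrm : 'cV[R]_n -> R) (hnrm : is_norm nrm)
  (hN : (0 < N)%N) (xihat : 'I_N -> 'cV[R]_n) (hxihat : forall m, Xi (xihat m))
  (theta : R) (htheta : 0 <= theta)
  (eps : R) (heps0 : 0 < eps) (heps1 : eps < 1)
  (* algorithm *)
  (kappa : forall i, 'I_#|W i|)
  (lambda : forall i, 'I_#|W i| -> R)
  (v : forall i, 'I_#|W i| -> 'cV[R]_#|W i|)
  (hv : forall i, is_eigen_system
          (emp_cov (fun m => subvec W i (xihat m))) (lambda i) (v i))
  (b : forall i, 'I_(#|W i| + kappa i) -> R * R)
  (hb : forall i (j : 'I_(#|W i| + kappa i)),
     interval_optimal (ambiguity_set nrm Xi xihat theta)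
       (1 - eps / (nDR kappa)%:R) (direction (v i) j) (b i j))
  (* robust solution *)
  (xstar : 'cV[R]_nx)
  (hxstar : is_optimal (fun x => dot c x)
     (robust_feasible Lambda beta e f F h (Xi_rob v b)) xstar) :
  drcc_feasible Lambda beta e f F h
    (ambiguity_set nrm Xi xihat theta) eps xstar.
Proof.
have [[xs_lin xs_safe] _] := hxstar.
split=> //; apply: le_ereal_inf_tmp => _ [Q MQ <-].
have Qrob : ((1 - eps)%:E <= Q (Xi_rob v b))%E.
  apply: Xi_rob_probability_ge => [|i j]; first exact: ltW.
  have [[_ +] _] := hb i j; rewrite interval_eventE => /le_trans; apply.
  by apply: ereal_inf_lbound; exists Q.
apply: (le_trans Qrob); apply: le_measure; rewrite ?inE.
- exact: measurable_Xi_rob.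
- exact: measurable_safe.
- by move=> xi rob_xi k; exact: xs_safe.
Qed.
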